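(* Let $G = (V,E)$ be a finite simple undirected graph without loops, with minimum degree $\delta(G)$ and number of vertices $|G|$, and let $c : E \to \{1,2,\dots\}$ be a proper edge-colouring of $G$. If $|G| \ge (9\delta(G) - 5)/2$, then $G$ contains a rainbow matching of size $\delta(G)$, that is, a set of $\delta(G)$ pairwise vertex-disjoint edges of $G$ whose colours under $c$ are pairwise distinct.
   Context: $|G|$ denotes the order (number of vertices) of $G$ and $\delta(G)$ its minimum degree. A proper edge-colouring of $G=(V,E)$ is a function $c:E\to\{1,2,\dots\}$ such that any two distinct adjacent edges (edges sharing a vertex) have distinct colours; a graph equipped with such a colouring is called a properly edge-coloured graph. A subgraph of $G$ is rainbow if its edges have pairwise distinct colours. A rainbow matching is a matching that is rainbow, and its size is its number of edges. *)

(* Defs.v *)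
From mathcomp Require Import all_boot all_order all_algebra.

Set Implicit Arguments.
Unset Strict Implicit.
Unset Printing Implicit Defensive.

(* A finite simple graph is a symmetric irreflexive relation e on its vertex
   type T; its edges are the two-element sets [set x; y] with e x y. *)

Definition edges (T : finType) (e : rel T) : {set {set T}} :=
  [set [set p.1; p.2] | p : T * T & e p.1 p.2].

Definition degree (T : finType) (e : rel T) (x : T) : nat :=
  #|[set y | e x y]|.

(* A loopless graph has degree e x < #|T| at every x, so the default value
   #|T| only matters for the graph without vertices, where it gives 0. *)
Definition min_degree (T : finType) (e : rel T) : nat :=
  \big[minn/#|T|]_(x : T) degree e x.

(* The colours are 1, 2, ...; the values of c outside edges e are irrelevant. *)
Definition proper_edge_colouring (T : finType) (e : rel T)
    (c : {set T} -> nat) : Prop :=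
  {in edges e, forall f, 0 < c f} /\
  {in edges e &, forall f g : {set T},
      f != g -> ~~ [disjoint f & g] -> c f != c g}.

Definition matching (T : finType) (e : rel T) (M : {set {set T}}) : Prop :=
  M \subset edges e /\ trivIset M.

Definition rainbow (T : finType) (c : {set T} -> nat) (M : {set {set T}}) :
    Prop :=
  {in M &, injective c}.

(* Main.v *)
Require Import Defs.
From mathcomp Require Import all_boot all_order all_algebra.
From mathcomp Require Import zify lra.

Set Implicit Arguments.
Unset Strict Implicit.
Unset Printing Implicit Defensive.

Import Num.Theory GRing.Theory.

(** A rainbow matching [M] with fewer edges than the minimum degree [d] can
always be enlarged by one edge, provided that [4 * #|M| < #|T|]; since
[(9 d - 5) / 2 >= 4 d - 3], the theorem follows by enlarging the empty
matching [d] times.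

Call a colour free when no edge of [M :\: F] has it, where [F] is a growing
part of [M].  The edges of [F] are those that can be exchanged: one end [x] of
each edge xy of [F] is joined to two private vertices [a], [b] outside [M] by
edges whose colours were free before xy entered [F].  Exchanging xy for xa or
xb gives up the colour of xy and the vertex [y], but takes the colour of xa or
xb; if an edge that entered [F] earlier has that colour, it is exchanged in
turn.  Such a cascade goes strictly back in the order of entry, so it stops.
Having two choices at each exchange leaves room for one extra demand: besides
giving up one free colour, a cascade can avoid a given vertex
([avoid_colour_vertex]) or give up a second free colour
([avoid_two_colours]).

Let [X] be the set of the ends [x] and [U] the set of the private vertices
chosen so far, and let [w] be a vertex outside [M] and [U].  Suppose that [M]
cannot be enlarged.  Then every edge wv of free colour has [v] in [X] or in
[cover (M :\: F)], because otherwise a suitable cascade makes room for wv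
([free_edge_extend]).  At most [#|X| <= #|F|] edges at [w] go to [X], and at
most [#|M :\: F|] have a colour that is not free, which is fewer than [d]
edges altogether; so some edge of free colour joins [w] to
[cover (M :\: F)] ([free_edge_at]).  There are more than [2 * #|M :\: F|] such
vertices [w], hence two of them share a neighbour [z] of this kind, and the
edge of [M] through [z] can enter [F] with these two as its private vertices
([switchable_grow]).  So [F] would grow beyond [M], which is absurd. *)

(** * Edges, colours and rainbow matchings *)

Section RainbowMatchings.

Variables (T : finType) (e : rel T) (c : {set T} -> nat).
Hypotheses (e_sym : symmetric e) (e_irr : irreflexive e).
Hypothesis c_proper : proper_edge_colouring e c.

Implicit Types (M F : {set {set T}}) (f g X U : {set T}).

Definition rainbow_matching M := matching e M /\ rainbow c M.

Definition colours M : seq nat := [seq c f | f in M].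

Lemma mem_colours M f : f \in M -> c f \in colours M.
Proof. exact: image_f. Qed.

Lemma coloursP M k :
  reflect (exists2 f, f \in M & k = c f) (k \in colours M).
Proof. exact: imageP. Qed.

Lemma colours_sub M1 M2 k :
  M1 \subset M2 -> k \notin colours M2 -> k \notin colours M1.
Proof.
move=> /subsetP s12; apply: contra => /coloursP[f /s12 fM2 ->].
exact: mem_colours.
Qed.

Lemma coloursU1 f M k :
  (k \in colours (f |: M)) = (k == c f) || (k \in colours M).
Proof.
apply/coloursP/orP => [[g /setU1P[->|gM] ->]|[/eqP->|/coloursP[g gM ->]]].
- by left.
- by right; apply: mem_colours.
- by exists f; rewrite ?setU11.
- by exists g; rewrite // setU1r.
Qed.

Lemma notin_coversP M x :
  reflect (forall f, f \in M -> x \notin f) (x \notin cover M).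
Proof.
apply: (iffP idP) => [xM f fM | xM].
  by apply: contra xM => xf; apply/bigcupP; exists f.
by apply/bigcupP => -[f /xM/negP fx xf]; exact: fx xf.
Qed.

Lemma mem_cover M f x : f \in M -> x \in f -> x \in cover M.
Proof. by move=> fM xf; apply/bigcupP; exists f. Qed.

Lemma edge_in_edges x y : e x y -> [set x; y] \in edges e.
Proof. by move=> exy; apply/imsetP; exists (x, y); rewrite ?inE. Qed.

Lemma edges_other f x :
  f \in edges e -> x \in f -> exists2 y, e x y & f = [set x; y].
Proof.
case/imsetP=> -[p q]; rewrite inE /= => epq -> /set2P[]->.
  by exists q.
by exists p; rewrite 1?e_sym // setUC.
Qed.

Lemma proper_at x y z :
  e x y -> e x z -> y != z -> c [set x; y] != c [set x; z].
Proof.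
move=> exy exz yz; apply: (c_proper.2); rewrite ?edge_in_edges //.
  apply: contra yz => /eqP/setP/(_ y).
  rewrite !inE eqxx orbT => /esym/orP[/eqP yx|//].
  by rewrite yx e_irr in exy.
by apply/negP => /disjointFr/(_ (set21 x y)); rewrite set21.
Qed.

Lemma rainbow_matchingU1 M x y :
    rainbow_matching M -> e x y -> x \notin cover M -> y \notin cover M ->
    c [set x; y] \notin colours M ->
  rainbow_matching ([set x; y] |: M) /\ #|[set x; y] |: M| = #|M|.+1.
Proof.
move=> [[Me Mtriv] Mrb] exy xM yM cM.
have fM : [set x; y] \notin M by apply: contra xM => /mem_cover; apply; exact: set21.
split; last by rewrite cardsU1 fM.
split; first split.
- by apply/subsetP => f /setU1P[->|/(subsetP Me)//]; apply: edge_in_edges.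
- apply/trivIsetP => f g.
  have disj h : h \in M -> [disjoint [set x; y] & h].
    move=> hM; rewrite disjoints_subset; apply/subsetP => z; rewrite in_setC.
    by case/set2P=> ->; apply: (notin_coversP M _ _ _ hM).
  move=> /setU1P[->|fM1] /setU1P[->|gM1]; rewrite ?eqxx // => fg.
  + exact: disj.
  + by rewrite disjoint_sym; apply: disj.
  + by move/trivIsetP: Mtriv; apply.
- move=> f g /setU1P[->|fM1] /setU1P[->|gM1] // fg.
  + by rewrite fg mem_colours in cM.
  + by rewrite -fg mem_colours in cM.
  + exact: Mrb.
Qed.

Lemma rainbow_matching_sub M1 M2 :
  M1 \subset M2 -> rainbow_matching M2 -> rainbow_matching M1.
Proof.
move=> s12 [[Me Mtriv] Mrb]; split; first split.
- exact: subset_trans Me.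
- exact: trivIsetS Mtriv.
- by move=> f g /(subsetP s12) fM /(subsetP s12) gM; apply: Mrb.
Qed.

Lemma rainbow_own_colour M f :
  rainbow c M -> f \in M -> c f \notin colours (M :\ f).
Proof.
move=> Mrb fM; apply/coloursP => -[g /setD1P[gf gM] cfg].
by rewrite (Mrb f g) ?eqxx in gf.
Qed.

Lemma matching_own_vertex M f x :
  trivIset M -> f \in M -> x \in f -> x \notin cover (M :\ f).
Proof.
move=> Mtriv fM xf; apply/notin_coversP => g /setD1P[gf gM].
move/trivIsetP: Mtriv => /(_ _ _ gM fM gf) /disjointFl/(_ xf) ->.
by [].
Qed.

(** * Exchanging edges of a matching *)

Section Switching.

Variable M : {set {set T}}.
Hypothesis M_rm : rainbow_matching M.

Definition spare F x v :=
  [/\ e x v, v \notin cover M & c [set x; v] \notin colours (M :\: F)].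

(** The arguments are the exchangeable edges [F], the set [X] of their ends that
stay covered, and the set [U] of their private vertices.  The derivation records
the order of entry: [spare] refers to the [F] of the moment, so that a cascade
of exchanges is a recursion on it. *)
Inductive switchable : {set {set T}} -> {set T} -> {set T} -> Prop :=
| switchable0 : switchable set0 set0 set0
| switchableU F X U x y a b :
    switchable F X U -> [set x; y] \in M :\: F -> spare F x a -> spare F x b ->
    a != b -> a \notin U -> b \notin U ->
  switchable ([set x; y] |: F) (x |: X) ([set a; b] :|: U).

(** The outcome of a cascade.  Keeping [M :\: F] makes every edge that has not
yet entered [F] available for exchange; the last clause locates the vertices
covered by [M']. *)
Definition rerouting F X U M' :=
  [/\ rainbow_matching M', #|M'| = #|M|, M :\: F \subset M' &
      forall f, f \in M' ->
        f \in M \/ exists x v, [/\ x \in X, v \in U & f = [set x; v]]].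

Lemma rerouting_sub F1 F2 X1 X2 U1 U2 M' :
    F1 \subset F2 -> X1 \subset X2 -> U1 \subset U2 ->
  rerouting F1 X1 U1 M' -> rerouting F2 X2 U2 M'.
Proof.
move=> sF /subsetP sX /subsetP sU [rmM' cardM' sM' inM']; split => //.
  exact: subset_trans (setDS _ sF) sM'.
move=> f /inM'[fM|[x [v [xX vU ->]]]]; [by left | right].
by exists x, v; split; auto.
Qed.

Lemma switchable_cover F X U : switchable F X U ->
  X \subset cover M.
Proof.
elim=> [|{}F {}X {}U x y a b _ sX fM _ _ _ _ _]; first exact: sub0set.
rewrite subUset sX andbT sub1set.
by apply: (mem_cover (f := [set x; y])); [case/setDP: fM | exact: set21].
Qed.

Lemma rerouting_cover F X U M' v :
    switchable F X U -> rerouting F X U M' ->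
  v \notin cover M -> v \notin U -> v \notin cover M'.
Proof.
move=> sw [_ _ _ inM'] vM vU; apply/notin_coversP => f /inM'[fM|].
  exact: (notin_coversP _ _ vM).
move=> [x [u [xX uU ->]]]; apply/negP => /set2P[] vE.
  by move/negP: vM; rewrite vE; apply; apply: (subsetP (switchable_cover sw)).
by rewrite vE uU in vU.
Qed.

(** One exchange. The colour of xy is given up for good because it occurred only
once in the rainbow matching [M0] and the colour of xv was absent from it. *)
Lemma rerouting_switch F X U M0 x y v :
    let M' := [set x; v] |: (M0 :\ [set x; y]) in
    switchable F X U -> rerouting F X U M0 -> [set x; y] \in M :\: F ->
    spare F x v -> v \notin U -> c [set x; v] \notin colours M0 ->
  rerouting ([set x; y] |: F) (x |: X) (v |: U) M' /\
    c [set x; y] \notin colours M'.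
Proof.
move=> M' sw re fMF [exv vM _] vU cv.
have vM0 := rerouting_cover sw re vM vU.
have [rmM0 cardM0 sM0 inM0] := re.
have fM0 := subsetP sM0 _ fMF.
have [[M0e M0triv] M0rb] := rmM0.
have rmD : rainbow_matching (M0 :\ [set x; y]).
  by apply: rainbow_matching_sub rmM0; apply: subD1set.
have [] := @rainbow_matchingU1 (M0 :\ [set x; y]) x v rmD exv.
- by apply: matching_own_vertex => //; apply: set21.
- apply/notin_coversP => g /setD1P[_ gM0].
  exact: (notin_coversP _ _ vM0).
- by apply: colours_sub cv; apply: subD1set.
rewrite -/M' => rmM' cardM'; split.
  split => //.
  - by rewrite cardM' -cardM0 [in RHS](cardsD1 [set x; y]) fM0.
  - apply/subsetP => g /setDP[gM]; rewrite !inE negb_or => /andP[-> gF].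
    by rewrite (subsetP sM0) ?orbT // inE gF gM.
  - move=> g /setU1P[->|/setD1P[_ /inM0[gM|[x' [v' [xX vU' ->]]]]]].
    + by right; exists x, v; rewrite !setU11.
    + by left.
    + by right; exists x', v'; rewrite !setU1r.
rewrite coloursU1 negb_or rainbow_own_colour // andbT.
by apply: contra cv => /eqP <-; apply: mem_colours.
Qed.

Lemma notin_coloursDU1 F f k :
    k \notin colours (M :\: (f |: F)) -> k != c f ->
  k \notin colours (M :\: F).
Proof.
move=> kM kf; apply: contra kM => /coloursP[g /setDP[gM gF] kE].
apply/coloursP; exists g => //; rewrite !inE negb_or gM gF !andbT.
by apply: contra kf => /eqP <-; rewrite kE.
Qed.

(** Going down the order of entry, the exchange of the edge of colour [k] uses
whichever of its two private vertices is not [u]; the colour taken is free one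
step earlier and becomes the new [k]. *)
Lemma avoid_colour_vertex F X U k u :
    switchable F X U -> k \notin colours (M :\: F) -> u \notin cover M ->
  exists M', [/\ rerouting F X U M', k \notin colours M' & u \notin cover M'].
Proof.
move=> sw + uM.
elim: sw k => [|{}F {}X {}U x y a b sw IH fMF sa sb ab aU bU] k kF.
  exists M; split=> //; last by rewrite setD0 in kF.
  by split=> //; [rewrite setD0 | left].
have [kE|kf] := eqVneq k (c [set x; y]); last first.
  have [M' [re kM' uM']] := IH _ (notin_coloursDU1 kF kf).
  by exists M'; split=> //; apply: rerouting_sub re; apply: subsetUr.
have [v [vab sv vU vu]] : exists v,
    [/\ v \in [set a; b], spare F x v, v \notin U & v != u].
  have [au|au] := eqVneq a u; last by exists a; rewrite set21.
  by exists b; rewrite set22 -au eq_sym.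
have [_ _ /IH[M0 [re kM0 uM0]]] := sv.
have [re' cf] := rerouting_switch sw re fMF sv vU kM0.
exists ([set x; v] |: (M0 :\ [set x; y])); split.
- by apply: rerouting_sub re' => //; apply: setSU; rewrite sub1set.
- by rewrite kE.
- have xM : x \in cover M.
    by apply: (mem_cover (f := [set x; y])); [case/setDP: fMF | exact: set21].
  apply/notin_coversP => g /setU1P[->|/setD1P[_ gM0]].
    rewrite !inE negb_or ![u == _]eq_sym vu andbT.
    by apply: contra uM => /eqP <-.
  exact: (notin_coversP _ _ uM0).
Qed.

(** Two cascades that give up [k] and [l] might collide on a common edge.  Going
down the order of entry with both colours at once prevents this: when the
latest edge has one of them, the two edges to its private vertices have
distinct colours, so one of these differs from the other demanded colour, and
again two distinct colours have to be given up one step earlier. *)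
Lemma avoid_two_colours F X U k l :
    switchable F X U -> k != l ->
    k \notin colours (M :\: F) -> l \notin colours (M :\: F) ->
  exists M', [/\ rerouting F X U M', k \notin colours M' & l \notin colours M'].
Proof.
move=> sw.
elim: sw k l => [|{}F {}X {}U x y a b sw IH fMF sa sb ab aU bU] k l kl kF lF.
  exists M; rewrite setD0 in kF lF; split=> //.
  by split=> //; [rewrite setD0 | left].
set f := [set x; y] in kF lF *.
(* [m] is the demanded colour other than that of the latest edge. *)
have switch m : m != c f -> m \notin colours (M :\: (f |: F)) ->
    exists M', [/\ rerouting (f |: F) (x |: X) ([set a; b] :|: U) M',
                   c f \notin colours M' & m \notin colours M'].
  move=> mf mF.
  have [v [vab sv vU vm]] : exists v,
      [/\ v \in [set a; b], spare F x v, v \notin U & c [set x; v] != m].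
    have [am|am] := eqVneq (c [set x; a]) m; last by exists a; rewrite set21.
    exists b; rewrite set22 -am; split=> //.
    by case: sa sb => [ea _ _] [eb _ _]; apply: proper_at; rewrite 1?eq_sym.
  have [_ _ cv] := sv.
  have [M0 [re vM0 mM0]] := IH _ _ vm cv (notin_coloursDU1 mF mf).
  have [re' cf] := rerouting_switch sw re fMF sv vU vM0.
  exists ([set x; v] |: (M0 :\ f)); split=> //.
  - by apply: rerouting_sub re' => //; apply: setSU; rewrite sub1set.
  - rewrite coloursU1 negb_or eq_sym vm.
    by apply: colours_sub mM0; apply: subD1set.
have [kf|kf] := eqVneq k (c f).
  by rewrite {}kf {kF} in kl *; apply: switch; rewrite 1?eq_sym.
have [lf|lf] := eqVneq l (c f).
  by rewrite lf; have [M' [? ? ?]] := switch _ kf kF; exists M'.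
have [M' [re kM' lM']] :=
  IH _ _ kl (notin_coloursDU1 kF kf) (notin_coloursDU1 lF lf).
by exists M'; split=> //; apply: rerouting_sub re; apply: subsetUr.
Qed.

Definition extendable :=
  exists M', rainbow_matching M' /\ #|M'| = #|M|.+1.

Lemma rerouting_extend F X U M' x y :
    rerouting F X U M' -> e x y -> x \notin cover M' -> y \notin cover M' ->
    c [set x; y] \notin colours M' ->
  extendable.
Proof.
move=> [rmM' cardM' _ _] exy xM' yM' cM'.
by exists ([set x; y] |: M'); rewrite -cardM'; apply: rainbow_matchingU1.
Qed.

Lemma switchable_spare F X U : switchable F X U -> U \subset ~: cover M.
Proof.
elim=> [|{}F {}X {}U x y a b _ sU _ [_ aM _] [_ bM _] _ _ _].
  exact: sub0set.
by rewrite !subUset !sub1set !inE aM bM.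
Qed.

Lemma switchable_stats F X U : switchable F X U ->
  [/\ F \subset M, #|X| <= #|F| & #|U| <= 2 * #|F|].
Proof.
elim=> [|{}F {}X {}U x y a b _ [sF cX cU] fMF _ _ _ _ _].
  by rewrite !cards0 sub0set.
have [fM fF] := setDP fMF; split.
- by rewrite subUset sub1set fM.
- rewrite cardsU1 [#|_ |: F|]cardsU1 fF.
  by rewrite leq_add // leq_b1.
- rewrite [#|_ |: F|]cardsU1 fF mulnDr.
  apply: leq_trans (leq_card_setU _ _) _.
  by rewrite leq_add // cards2; case: (a != b).
Qed.

(** If [v] is outside [M], a cascade gives up the colour of wv while avoiding
[v], which may be a private vertex.  Otherwise [v] is the end outside [X] of
an edge of [F]: giving up the colour of that edge as well removes it, and
nothing else can cover [v]. *)
Lemma free_edge_extend F X U w v :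
    switchable F X U -> w \notin cover M -> w \notin U -> e w v ->
    v \notin X -> v \notin cover (M :\: F) ->
    c [set w; v] \notin colours (M :\: F) ->
  extendable.
Proof.
move=> sw wM wU ewv vX vMF cF.
have [vM|vM] := boolP (v \in cover M); last first.
  have [M' [re cM' vM']] := avoid_colour_vertex sw cF vM.
  by apply: (rerouting_extend re ewv _ vM' cM'); apply: (rerouting_cover sw re).
have [f fM vf] := bigcupP vM.
have [[Me Mtriv] Mrb] := M_rm.
have fF : f \in F.
  by apply: contraR vMF => fF; apply: (mem_cover (f := f)); rewrite // inE fF.
have cfF : c f \notin colours (M :\: F).
  apply: colours_sub (rainbow_own_colour Mrb fM).
  by apply: setDS; rewrite sub1set.
have cfwv : c f != c [set w; v].
  have [y evy fE] := edges_other (subsetP Me _ fM) vf.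
  rewrite fE [X in _ != c X]setUC.
  apply: proper_at; rewrite // 1?e_sym //.
  by apply: contra wM => /eqP <-; apply: (mem_cover fM); rewrite fE set22.
have [M' [re cfM' cM']] := avoid_two_colours sw cfwv cfF cF.
apply: (rerouting_extend re ewv _ _ cM'); first exact: (rerouting_cover sw re).
have [_ _ _ inM'] := re.
apply/notin_coversP => g gM'; apply/negP => vg.
have [gM|[x [u [xX uU gE]]]] := inM' _ gM'.
  have gf : g = f.
    apply/eqP; apply: contraTT vg => gf.
    by apply: (notin_coversP _ _ (matching_own_vertex Mtriv fM vf)); rewrite !inE gf.
  by rewrite -gf mem_colours in cfM'.
move: vg; rewrite gE => /set2P[] vE; first by rewrite vE xX in vX.
by have := subsetP (switchable_spare sw) _ uU; rewrite in_setC -vE vM.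
Qed.

(** By properness the edges at [w] whose colour is not free number at most
[#|M :\: F|], so the degree of [w] would be at most [#|F| + #|M :\: F|] if all
its other edges went to [X]. *)
Lemma free_edge_at F X U d w :
    switchable F X U -> #|M| < d -> d <= degree e w ->
    w \notin cover M -> w \notin U ->
  extendable \/
  exists z, [/\ e w z, z \in cover (M :\: F) &
                c [set w; z] \notin colours (M :\: F)].
Proof.
move=> sw Md dw wM wU.
have [sF cX _] := switchable_stats sw.
pose free := [set v | e w v & c [set w; v] \notin colours (M :\: F)].
have [sfree|] := boolP (free \subset X); last first.
  case/subsetPn=> v; rewrite inE => /andP[ewv cv] vX.
  have [vMF|vMF] := boolP (v \in cover (M :\: F)); first by right; exists v.
  by left; apply: (free_edge_extend sw wM wU ewv vX vMF cv).
pose tied := [set y | e w y] :\: free.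
have ctied : #|tied| <= #|M :\: F|.
  rewrite -(size_image (fun v => c [set w; v])) -(size_image c).
  apply: uniq_leq_size => [|k /imageP[v]].
    rewrite map_inj_in_uniq ?enum_uniq // => u v; rewrite !mem_enum !inE.
    move=> /andP[_ ewu] /andP[_ ewv] /eqP; apply: contraTeq => uv.
    exact: proper_at.
  by rewrite !inE negb_and negbK => /andP[/orP[/negP//|cv _ ->]].
have := cardsID free [set y | e w y].
have := subset_leq_card (subsetIr [set y | e w y] free).
have := subset_leq_card sfree.
have := cardsDS sF.
have := subset_leq_card sF.
rewrite /degree in dw; rewrite -/tied; lia.
Qed.

Lemma leq_card_matching_cover F : F \subset M -> #|cover F| <= 2 * #|F|.
Proof.
move=> sF; apply: leq_trans (leq_card_cover F) _.
rewrite mulnC -sum_nat_const; apply: leq_sum => f /(subsetP sF) fM.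
have /imsetP[[x y] _ ->] := subsetP M_rm.1.1 _ fM.
by rewrite cards2; case: (_ != _).
Qed.

(** Outside [M] and [U] there are at least [#|T| - 2 * #|M| - 2 * #|F|] vertices,
more than the [2 * (#|M| - #|F|)] vertices that [M :\: F] covers. *)
Lemma switchable_grow F X U d :
    switchable F X U -> #|M| < d -> (forall x, d <= degree e x) ->
    4 * #|M| < #|T| ->
  extendable \/
  exists F' X' U', switchable F' X' U' /\ #|F'| = #|F|.+1.
Proof.
move=> sw Md degd cardT.
have [sF cX cU] := switchable_stats sw.
pose W := ~: (cover M :|: U).
pose free w z := [&& e w z, z \in cover (M :\: F) &
                    c [set w; z] \notin colours (M :\: F)].
have WP w : w \in W -> w \notin cover M /\ w \notin U.
  by rewrite !inE negb_or => /andP.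
have [allfree|] := boolP [forall w in W, [exists z, free w z]]; last first.
  rewrite negb_forall_in => /exists_inP[w /WP[wM wU]].
  rewrite negb_exists => /forallP nfree; left.
  have [//|[z [ewz zMF cz]]] := free_edge_at sw Md (degd w) wM wU.
  by move: (nfree z); rewrite /free ewz zMF cz.
pose g w := odflt w [pick z | free w z].
have gP w : w \in W -> free w (g w).
  move=> wW; rewrite /g; case: pickP => //= nfree.
  have /forall_inP/(_ _ wW)/existsP[z] := allfree.
  by rewrite nfree.
(* [g] cannot be injective on [W]: it maps [W] into a smaller set. *)
have /dinjectivePn[a aW [b /andP[ba bW] gab]] : ~~ dinjectiveb g W.
  apply/negP => /dinjectiveP/card_in_imset cardgW.
  have : #|g @: W| <= #|cover (M :\: F)|.
    apply: subset_leq_card; apply/subsetP => _ /imsetP[w wW ->].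
    by have /and3P[] := gP _ wW.
  have := leq_card_matching_cover (subsetDl M F).
  have := leq_card_matching_cover (subxx M).
  have := cardsDS sF; have := subset_leq_card sF.
  have := cardsC (cover M :|: U); have [+ _] := leq_card_setU (cover M) U.
  rewrite cardgW -/W; lia.
right; have /and3P[eaz /bigcupP[f fMF zf] caz] := gP _ aW.
have /and3P[] := gP _ bW; rewrite -gab => ebz _ cbz.
have [fM fF] := setDP fMF.
have [y _ fE] := edges_other (subsetP M_rm.1.1 _ fM) zf.
have [[aM aU] [bM bU]] := (WP _ aW, WP _ bW).
exists (f |: F), (g a |: X), ([set a; b] :|: U); split; last first.
  by rewrite cardsU1 fF.
rewrite fE; apply: switchableU => //; first by rewrite -fE.
- by split; rewrite // 1?e_sym // setUC.
- by split; rewrite // 1?e_sym // setUC.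
- by rewrite eq_sym.
Qed.

(** If [M] could not be enlarged, [F] could grow to have more edges than [M], of
which it is a part. *)
Lemma rainbow_matching_extend d :
    #|M| < d -> (forall x, d <= degree e x) -> 4 * #|M| < #|T| ->
  extendable.
Proof.
move=> Md degd cardT.
have [//|[F [X [U [sw cF]]]]] : extendable \/
    exists F X U, switchable F X U /\ #|F| = #|M|.+1.
  elim: #|M|.+1 => [|k [|[F [X [U [sw <-]]]]]].
  - right; exists set0, set0, set0; split; [exact: switchable0 | exact: cards0].
  - by left.
  - exact: switchable_grow sw Md degd cardT.
have [/subset_leq_card] := switchable_stats sw.
by rewrite cF ltnn.
Qed.

End Switching.

(** * The theorem *)

Lemma rainbow_matching_of_degree d k :
    (forall x, d <= degree e x) -> 4 * d <= #|T| + 3 -> k <= d ->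
  exists M, rainbow_matching M /\ #|M| = k.
Proof.
move=> degd cardT; elim: k => [_|k IH kd].
  exists set0; rewrite cards0; split=> //; split; first split.
  - exact: sub0set.
  - by apply/trivIsetP => f g; rewrite inE.
  - by move=> f g; rewrite inE.
have [M [M_rm cM]] := IH (ltnW kd).
rewrite -cM; apply: (rainbow_matching_extend M_rm _ degd); lia.
Qed.

End RainbowMatchings.

Lemma min_degree_leq (T : finType) (e : rel T) x :
  min_degree e <= degree e x.
Proof.
rewrite /min_degree; have := mem_index_enum x.
elim: (index_enum T) => // y s IH; rewrite inE big_cons geq_min.
by case/predU1P=> [->|/IH ->]; rewrite ?leqnn ?orbT.
Qed.

Theorem theorem1p1 (T : finType) (e : rel T) (c : {set T} -> nat)
    (e_sym : symmetric e) (e_irr : irreflexive e)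
    (c_proper : proper_edge_colouring e c)
    (card_G : ((9 * (min_degree e)%:R - 5) / 2 <= (#|T|%:R : rat))%R) :
  exists M : {set {set T}},
    [/\ matching e M, rainbow c M & #|M| = min_degree e].
Proof.
have card_nat : 9 * min_degree e <= 2 * #|T| + 5.
  rewrite -(ler_nat rat) natrD !natrM; lra.
have [|M [[? ?] ?]] := rainbow_matching_of_degree e_sym e_irr c_proper
  (min_degree_leq e) _ (leqnn _); first lia.
by exists M.
Qed.
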